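(* Let $m\in\mathcal{A}^c$ and $(g_1,g_2)\in SL(V)\times SL(V)$. Then: (i) $D_{{}^{(g_1,g_2)}m}=g_2\cdot D_m$; (ii) $\mathrm{Disc}(D_{{}^{(g_1,g_2)}m})=\mathrm{Disc}(D_m)$.
   Context: $\mathbb{F}$ is a field of characteristic different from $2$ and $3$, and $V$ is a two-dimensional $\mathbb{F}$-vector space. $\mathcal{A}^c$ is the set of symmetric bilinear maps $m:V\times V\to V$. For $m\in\mathcal{A}^c$, $D_m$ is the quadratic form on $V$ given by $D_m(v)=\det(L_v)$, where $L_v(w)=m(v,w)$. For a quadratic form $q(xe_1+ye_2)=\alpha x^2+\beta xy+\gamma y^2$ in a basis $(e_1,e_2)$ with dual basis $(\epsilon_1,\epsilon_2)$, $\mathrm{Disc}(q)=(\beta^2-4\alpha\gamma)(\epsilon_1\wedge\epsilon_2)^{\otimes2}\in\Lambda^2(V^* )^{\otimes2}$ (independent of the basis). $SL(V)\times SL(V)$ acts on $\mathcal{A}^c$ by $({}^{(g_1,g_2)}m)(u,v)=g_1\,m(g_2^{-1}u,g_2^{-1}v)$, and $SL(V)$ acts on quadratic forms by $(g\cdot q)(u)=q(g^{-1}u)$. *)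

(* Defs.v *)
From HB Require Import structures.
From mathcomp Require Import all_boot all_order all_algebra ring.

Set Implicit Arguments.
Unset Strict Implicit.
Unset Printing Implicit Defensive.

Import GRing.Theory.
Import passmx.
Local Open Scope ring_scope.

Section Determinant.
Variables (F : fieldType) (V : vectType F).

Definition lfdet (f : 'End(V)) : F :=
  \det (mxof (vbasis {:V}) (vbasis {:V}) f).

Lemma lfdetE (e : (\dim {:V}).-tuple V) (f : 'End(V)) :
  basis_of {:V} e -> lfdet f = \det (mxof e e f).
Proof.
move=> be; have bb := vbasisP {:V}.
set b := vbasis {:V} in bb *.
have fE : f = (\1 \o (f \o \1))%VF by rewrite comp_lfun1l comp_lfun1r.
have one : mxof e b \1 *m mxof b e \1 = 1%:M.
  by rewrite -(mxof_comp e e bb) comp_lfun1l mxof1 ?(basis_free be).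
rewrite /lfdet -/b [in RHS]fE (mxof_comp e e bb) (mxof_comp e b bb) !det_mulmx.
by rewrite mulrAC -det_mulmx one det1 mul1r.
Qed.

Lemma lfdet_comp (f g : 'End(V)) : lfdet (f \o g)%VF = lfdet f * lfdet g.
Proof. by rewrite /lfdet (mxof_comp _ _ (vbasisP _)) det_mulmx mulrC. Qed.

Record SL := MkSL { SL_val :> 'End(V); SL_det : lfdet SL_val = 1 }.

Lemma SL_ker0 (g : SL) : lker g == 0%VS.
Proof.
apply/lker0P => u v guv; have bb := vbasisP {:V}.
have mg : mxof (vbasis {:V}) (vbasis {:V}) g \in unitmx.
  by rewrite unitmxE -/(lfdet g) SL_det unitr1.
apply: (can_inj (rVofK bb)); apply: (can_inj (mulmxK mg)).
by rewrite -!(rVof_app _ bb) guv.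
Qed.

(* [f^-1%VF] is total in the library; on SL it is the genuine inverse. *)
Lemma SL_invK (g : SL) : cancel g (g^-1)%VF.
Proof. exact: lker0_lfunK (SL_ker0 g). Qed.

Lemma SL_Kinv (g : SL) : cancel (g^-1)%VF g.
Proof. exact: lker0_lfunVK (SL_ker0 g). Qed.

End Determinant.

Section SymmetricBilinear.
Variables (F : fieldType) (V : vectType F).

Record symBilin := SymBilin {
  symBilin_val :> {bilinear V -> V -> V};
  symBilinC : forall u v, symBilin_val u v = symBilin_val v u }.

Section Action.
Variables (g1 g2 : SL V) (m : symBilin).

Definition act_fun (u v : V) : V := g1 (m ((g2^-1)%VF u) ((g2^-1)%VF v)).

Lemma act_fun_bilinear : bilinear_for *:%R *:%R act_fun.
Proof.
by split=> w a u v; rewrite /act_fun linearP ?linearPl ?linearPr linearP.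
Qed.

HB.instance Definition _ :=
  bilinear_isBilinear.Build F V V V *:%R *:%R act_fun act_fun_bilinear.

Lemma act_funC u v : act_fun u v = act_fun v u.
Proof. by rewrite /act_fun symBilinC. Qed.

Definition act : symBilin := @SymBilin act_fun act_funC.

End Action.
End SymmetricBilinear.

Section QuadraticForms.
Variables (F : fieldType) (V : vectType F).

Definition polar (q : V -> F) (u v : V) : F := q (u + v) - q u - q v.

Record quadForm := QuadForm {
  quadForm_val :> V -> F;
  quadFormZ : forall a v, quadForm_val (a *: v) = a ^+ 2 * quadForm_val v;
  quadForm_polar : bilinear_for *%R *%R (polar quadForm_val) }.

Lemma quadForm_coord (q : quadForm) (e1 e2 : V) (x y : F) :
  q (x *: e1 + y *: e2) = q e1 * x ^+ 2 + polar q e1 e2 * x * y + q e2 * y ^+ 2.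
Proof.
have [Pl Pr] := quadForm_polar q.
have q0 : q 0 = 0 by rewrite -(scale0r 0) quadFormZ expr0n mul0r.
have p0l v : polar q 0 v = 0 by rewrite /polar add0r q0 subr0 subrr.
have p0r v : polar q v 0 = 0 by rewrite /polar addr0 q0 subr0 subrr.
have := Pl (y *: e2) x e1 0; rewrite /= addr0 p0l addr0.
have := Pr e1 y e2 0; rewrite /= addr0 p0r addr0 => -> /eqP.
rewrite {1}/polar !quadFormZ !subr_eq => /eqP ->; ring.
Qed.

Lemma qact_subproofZ (g : SL V) (q : quadForm) a v :
  q ((g^-1)%VF (a *: v)) = a ^+ 2 * q ((g^-1)%VF v).
Proof. by rewrite linearZ quadFormZ. Qed.

Lemma qact_subproof_polar (g : SL V) (q : quadForm) :
  bilinear_for *%R *%R (polar (fun u => q ((g^-1)%VF u))).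
Proof.
have [Pl Pr] := quadForm_polar q.
have E u v : polar (fun u => q ((g^-1)%VF u)) u v
             = polar q ((g^-1)%VF u) ((g^-1)%VF v) by rewrite /polar linearD.
by split=> w a u v; rewrite !E linearP ?Pl ?Pr.
Qed.

Definition qact (g : SL V) (q : quadForm) : quadForm :=
  QuadForm (qact_subproofZ g q) (qact_subproof_polar g q).

(* The wedge of two covectors is viewed as an alternating bilinear form, and
   the tensor square of an element of Lambda^2(V^* ) as a 4-linear form; this
   embeds Lambda^2(V^* )^{(x) 2} faithfully into functions of four vectors. *)
Definition wedge (phi psi : V -> F) (u v : V) : F :=
  phi u * psi v - phi v * psi u.

Definition tensor2 (w : V -> V -> F) (u v u' v' : V) : F := w u v * w u' v'.

Definition disc_in (e : 2.-tuple V) (q : quadForm) : V -> V -> V -> V -> F :=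
  let e1 := tnth e 0 in let e2 := tnth e 1 in
  fun u v u' v' =>
    (polar q e1 e2 ^+ 2 - 4%:R * q e1 * q e2)
    * tensor2 (wedge (coord e 0) (coord e 1)) u v u' v'.

End QuadraticForms.

Section Dimension2.
Variables (F : fieldType) (V : vectType F) (dimV : \dim {:V} = 2%N).

Definition Disc (q : quadForm V) : V -> V -> V -> V -> F :=
  disc_in (tcast dimV (vbasis {:V})) q.

Lemma disc_in_basis (e b : 2.-tuple V) (q : quadForm V) u v u' v' :
  basis_of {:V} e -> basis_of {:V} b ->
  disc_in e q u v u' v' = disc_in b q u v u' v'.
Proof.
move=> be bb.
have b2 w : w = coord b 0 w *: tnth b 0 + coord b 1 w *: tnth b 1.
  rewrite {1}(coord_basis bb (memvf w)) big_ord_recl big_ord1.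
  have -> : lift ord0 ord0 = 1 :> 'I_2 by apply: val_inj.
  by rewrite -!tnth_nth.
have ce i w : coord e i w = coord b 0 w * coord e i (tnth b 0)
                          + coord b 1 w * coord e i (tnth b 1).
  by rewrite {1}(b2 w) linearD !linearZ.
have cef i j : coord e i (tnth e j) = (i == j)%:R.
  by rewrite (tnth_nth 0) coord_free ?(basis_free be)// eq_sym.
have e2 i : tnth e i = coord b 0 (tnth e i) *: tnth b 0
                     + coord b 1 (tnth e i) *: tnth b 1 by exact: b2.
have pE : polar q (tnth e 0) (tnth e 1)
  = q (tnth e 0 + tnth e 1) - q (tnth e 0) - q (tnth e 1) by [].
have sE : tnth e 0 + tnth e 1
   = (coord b 0 (tnth e 0) + coord b 0 (tnth e 1)) *: tnth b 0
   + (coord b 1 (tnth e 0) + coord b 1 (tnth e 1)) *: tnth b 1.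
  by rewrite {1}(e2 0) {1}(e2 1) !scalerDl addrACA.
have qE i : q (tnth e i) = q (tnth b 0) * coord b 0 (tnth e i) ^+ 2
    + polar q (tnth b 0) (tnth b 1) * coord b 0 (tnth e i) * coord b 1 (tnth e i)
    + q (tnth b 1) * coord b 1 (tnth e i) ^+ 2.
  by rewrite {1}(e2 i) quadForm_coord.
have k00 := ce 0 (tnth e 0); have k01 := ce 0 (tnth e 1).
have k10 := ce 1 (tnth e 0); have k11 := ce 1 (tnth e 1).
rewrite !cef /= in k00 k01 k10 k11.
rewrite /disc_in /tensor2 /wedge pE sE.
rewrite quadForm_coord (qE 0) (qE 1).
rewrite !(ce _ u) !(ce _ v) !(ce _ u') !(ce _ v').
set A := coord b 0 (tnth e 0) in k00 k01 k10 k11 *.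
set B := coord b 1 (tnth e 0) in k00 k01 k10 k11 *.
set C := coord b 0 (tnth e 1) in k00 k01 k10 k11 *.
set D := coord b 1 (tnth e 1) in k00 k01 k10 k11 *.
move: k00 k01 k10 k11.
set a := coord e 0 (tnth b 0); set a' := coord e 0 (tnth b 1).
set c := coord e 1 (tnth b 0); set c' := coord e 1 (tnth b 1).
move=> k00 k01 k10 k11.
have dd : (A * D - B * C) * (a * c' - a' * c) = 1.
  transitivity ((A * a + B * a') * (C * c + D * c')
                - (A * c + B * c') * (C * a + D * a')); first by ring.
  by rewrite -k00 -k01 -k10 -k11; ring.
set p := polar _ _ _; set q0 := q _; set q1 := q _.
set X := (coord b 0 u * coord b 1 v - coord b 0 v * coord b 1 u)
       * (coord b 0 u' * coord b 1 v' - coord b 0 v' * coord b 1 u').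
transitivity ((p ^+ 2 - 4 * q0 * q1) * X
  * ((A * D - B * C) * (a * c' - a' * c)) ^+ 2); first by rewrite /X; ring.
by rewrite dd expr1n mulr1.
Qed.

Lemma DiscE (e : 2.-tuple V) (q : quadForm V) u v u' v' :
  basis_of {:V} e -> Disc q u v u' v' = disc_in e q u v u' v'.
Proof.
move=> be; apply: disc_in_basis => //.
by rewrite val_tcast vbasisP.
Qed.

Section Dform.
Variable m : symBilin V.

Definition lmult (v : V) : 'End(V) := linfun (m v).

Lemma det_polar2 n (A B C : 'M[F]_n) a : n = 2%N ->
  \det (a *: A + B + C) - \det (a *: A + B) - \det C
  = a * (\det (A + C) - \det A - \det C) + (\det (B + C) - \det B - \det C).
Proof.
move=> n2; subst n.
have det2 (M : 'M[F]_2) : \det M = M 0 0 * M 1 1 - M 0 1 * M 1 0.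
  rewrite (expand_det_row _ 0) big_ord_recl big_ord1 /cofactor !det_mx11 !mxE /=.
  rewrite expr0 expr1 mul1r mulN1r mulrN.
  by congr (M _ _ * M _ _ - M _ _ * M _ _); apply: val_inj.
by rewrite !det2 !mxE; ring.
Qed.

Lemma D_subproofZ a v : lfdet (lmult (a *: v)) = a ^+ 2 * lfdet (lmult v).
Proof.
have -> : lmult (a *: v) = a *: lmult v.
  by apply/lfunP=> w; do !rewrite lfunE /=; rewrite linearZl_LR.
by rewrite /lfdet linearZ detZ; congr (_ ^+ _ * _).
Qed.

Lemma D_subproof_polar :
  bilinear_for *%R *%R (polar (fun v => lfdet (lmult v))).
Proof.
have Pl w a u v : polar (fun v => lfdet (lmult v)) (a *: u + v) w
  = a * polar (fun v => lfdet (lmult v)) u w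
    + polar (fun v => lfdet (lmult v)) v w.
  have lmultZ x : lmult (a *: x) = a *: lmult x.
    by apply/lfunP=> t; do !rewrite lfunE /=; rewrite linearZl_LR.
  have lmultD x y : lmult (x + y) = lmult x + lmult y.
    by apply/lfunP=> t; do !rewrite lfunE /=; rewrite linearDl.
  by rewrite /polar !lmultD !lmultZ /lfdet !linearD linearZ /= det_polar2.
split=> w a u v /=; first exact: Pl.
have C x y : polar (fun v => lfdet (lmult v)) x y
           = polar (fun v => lfdet (lmult v)) y x.
  by rewrite /polar [y + x]addrC addrAC.
by rewrite !(C w) Pl.
Qed.

Definition Dform : quadForm V := QuadForm D_subproofZ D_subproof_polar.

End Dform.
End Dimension2.

(* Main.v *)
Require Import Defs.
From mathcomp Require Import all_boot all_order all_algebra.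

(** Left multiplication by [v] in the transformed algebra is
    [g1 \o L_w \o g2^-1] with [w = g2^-1 v] ([lmult_act]).  Both [g1] and [g2^-1] have
    determinant 1, so multiplicativity of the determinant gives (i).

    Given (i), statement (ii) says that the discriminant of any quadratic form
    is invariant under [SL].  Fix a basis [e] and write [f = g^-1].  The
    coefficients of [g . q] in [e] are those of [q] in the basis [f e]
    ([discr_coef_qact]).  Since the 4-linear form [Disc q] can be computed in
    any basis, evaluating it on the vectors of [f e] compares the scalars
    [beta ^ 2 - 4 alpha gamma] obtained in [e] and in [f e]: their ratio is the
    square of the change-of-basis determinant ([discr_coef_change]).  That
    determinant is the determinant of [f] ([lfdet_wedge]), hence 1. *)

Import GRing.Theory.
Import passmx.
Local Open Scope ring_scope.

Section SpecialLinear.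
Context {F : fieldType} {V : vectType F}.

Lemma lfdet1 : lfdet (\1%VF : 'End(V)) = 1.
Proof. by rewrite /lfdet mxof1 ?det1 // (basis_free (vbasisP _)). Qed.

Lemma lfdet_SLV (g : SL V) : lfdet (g^-1)%VF = 1.
Proof.
have gK : (g \o g^-1)%VF = \1%VF.
  by apply/lfunP => v; rewrite !lfunE /= SL_Kinv.
by have := lfdet_comp g (g^-1)%VF; rewrite gK lfdet1 SL_det mul1r => <-.
Qed.

Definition SLV (g : SL V) : SL V := MkSL (lfdet_SLV g).

Lemma basis_SL (g : SL V) {n} (e : n.-tuple V) :
  basis_of {:V} e -> basis_of {:V} (map_tuple g e).
Proof.
move=> be; have kerg := SL_ker0 g.
rewrite -(lker0_limgf kerg); apply: limg_basis_of be.
by rewrite (eqP kerg) capv0.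
Qed.

(** Taking an [n]-tuple for the basis allows indexing by ['I_2] when
    [\dim {:V}] is only propositionally equal to 2. *)
Lemma lfdet_coord {n} (dimV : \dim {:V} = n) (e : n.-tuple V) (f : 'End(V)) :
  basis_of {:V} e ->
  lfdet f = \det (\matrix_(i < n, j < n) coord e j (f (tnth e i))).
Proof.
subst n => be; rewrite (lfdetE f be); congr (\det _).
by apply/matrixP => i j; rewrite !mxE /= vecof_delta -tnth_nth.
Qed.

Lemma lmult_act (g1 g2 : SL V) (m : symBilin V) v :
  lmult (act g1 g2 m) v = (g1 \o (lmult m ((g2^-1)%VF v) \o g2^-1))%VF.
Proof. by apply/lfunP => w; do !rewrite lfunE /=. Qed.

Lemma Dform_act (dimV : \dim {:V} = 2%N) (g1 g2 : SL V) (m : symBilin V) :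
  Dform dimV (act g1 g2 m) =1 qact g2 (Dform dimV m).
Proof.
by move=> v; rewrite /= lmult_act !lfdet_comp SL_det lfdet_SLV mul1r mulr1.
Qed.

End SpecialLinear.

Section Discriminant.
Context {F : fieldType} {V : vectType F}.
Implicit Types (e b : 2.-tuple V) (q : V -> F).

(** The scalar [beta ^ 2 - 4 alpha gamma], where [alpha, beta, gamma] are the
    coefficients of [q] in the basis [e]. *)
Definition discr_coef e q : F :=
  polar q (tnth e 0) (tnth e 1) ^+ 2 - 4%:R * q (tnth e 0) * q (tnth e 1).

Lemma eq_discr_coef e q q' : q =1 q' -> discr_coef e q = discr_coef e q'.
Proof. by move=> eqq; rewrite /discr_coef /polar !eqq. Qed.

Lemma discr_coef_qact e (g : SL V) (q : quadForm V) :
  discr_coef e (qact g q) = discr_coef (map_tuple (SLV g) e) q.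
Proof. by rewrite /discr_coef /polar /= linearD !tnth_map. Qed.

Lemma wedge_coord_basis e : basis_of {:V} e ->
  wedge (coord e 0) (coord e 1) (tnth e 0) (tnth e 1) = 1.
Proof.
move=> /basis_free fe; rewrite /wedge !(tnth_nth 0) !coord_free //=.
by rewrite mulr0 subr0 mulr1.
Qed.

(** Both sides are values of the basis-independent form [disc_in] on
    [(b_0, b_1, b_0, b_1)]; computed in [b] itself, its wedge factors are 1. *)
Lemma discr_coef_change e b (q : quadForm V) :
  basis_of {:V} e -> basis_of {:V} b ->
  discr_coef b q = discr_coef e q *
    wedge (coord e 0) (coord e 1) (tnth b 0) (tnth b 1) ^+ 2.
Proof.
move=> be bb.
have := disc_in_basis q (tnth b 0) (tnth b 1) (tnth b 0) (tnth b 1) bb be.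
by rewrite /disc_in /tensor2 (wedge_coord_basis _ bb) !mulr1 -expr2.
Qed.

Lemma lfdet_wedge (dimV : \dim {:V} = 2%N) e (f : 'End(V)) :
  basis_of {:V} e ->
  lfdet f = wedge (coord e 0) (coord e 1) (f (tnth e 0)) (f (tnth e 1)).
Proof.
move=> be; rewrite (lfdet_coord dimV e f be).
rewrite (expand_det_row _ 0) big_ord_recl big_ord1 /cofactor !det_mx11 !mxE /=.
rewrite expr0 expr1 mul1r mulN1r mulrN /wedge.
have -> : lift 0 0 = 1 :> 'I_2 by apply: val_inj.
have -> : lift 1 0 = 0 :> 'I_2 by apply: val_inj.
by rewrite [X in _ - X]mulrC.
Qed.

Lemma discr_coef_SL (dimV : \dim {:V} = 2%N) e (g : SL V) (q : quadForm V) :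
  basis_of {:V} e -> discr_coef e (qact g q) = discr_coef e q.
Proof.
move=> be; rewrite discr_coef_qact.
rewrite (discr_coef_change e _ q be (basis_SL (SLV g) e be)) !tnth_map.
by rewrite -(lfdet_wedge dimV) // SL_det expr1n mulr1.
Qed.

(** For a fixed basis, the whole 4-linear form is the same expression in the
    scalar [discr_coef], so equal scalars give equal functions. *)
Lemma Disc_eq (dimV : \dim {:V} = 2%N) (q q' : quadForm V) :
  (forall e, basis_of {:V} e -> discr_coef e q = discr_coef e q') ->
  Disc dimV q = Disc dimV q'.
Proof.
move=> eqd; rewrite /Disc /disc_in -!/(discr_coef _ _) eqd //.
by rewrite val_tcast vbasisP.
Qed.

End Discriminant.

Theorem proposition8p1 (F : fieldType) (charF2 : 2%N \notin [pchar F])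
    (charF3 : 3%N \notin [pchar F]) (V : vectType F) (dimV : \dim {:V} = 2%N)
    (m : symBilin V) (g1 g2 : SL V) :
  (Dform dimV (act g1 g2 m) =1 qact g2 (Dform dimV m)) /\
  (Disc dimV (Dform dimV (act g1 g2 m)) = Disc dimV (Dform dimV m)).
Proof.
split; first exact: Dform_act.
apply: Disc_eq => e be.
by rewrite (eq_discr_coef _ _ _ (Dform_act _ _ _ _)) discr_coef_SL.
Qed.
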